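(* Let $\mu>0$. The quadratic Hencky energy $$W_H(F)=\mu\sum_{i=1}^3\log^2\lambda_i,\qquad F\in\mathrm{SL}(3),$$ where $\lambda_1,\lambda_2,\lambda_3$ are the singular values of $F$, is not rank-one convex on $\mathrm{SL}(3)$.
   Context: $\mathrm{SL}(3)$ is the set of real $3\times3$ matrices with determinant $1$. Singular values are counted with multiplicity; $\log^2\lambda=(\log\lambda)^2$. A function $W\colon\mathrm{SL}(3)\to\mathbb{R}$ is rank-one convex on $\mathrm{SL}(3)$ if, for all $F\in\mathrm{SL}(3)$ and $a,b\in\mathbb{R}^3$ such that $F_t=F+t\,a\otimes b\in\mathrm{SL}(3)$ for all $t\in[0,1]$, the function $t\mapsto W(F_t)$ is convex on $[0,1]$. Here $a\otimes b=ab^T$. *)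

(* Defs.v *)
From mathcomp Require Import all_boot all_order all_algebra.
From mathcomp Require Import polyrcf.
From mathcomp Require Import boolp classical_sets set_interval reals.
From mathcomp Require Import topology normedtype exp convex.

Set Implicit Arguments.
Unset Strict Implicit.
Unset Printing Implicit Defensive.

Import Order.TTheory GRing.Theory Num.Theory.

Local Open Scope classical_set_scope.
Local Open Scope ring_scope.

(* The square roots of the eigenvalues of F^T F. [rootsR] lists each distinct
   real root once, hence the repetition according to multiplicity; all roots
   of this characteristic polynomial are real because F^T F is symmetric. *)
Definition singular_values (R : realType) (n : nat) (F : 'M[R]_n) : seq R :=
  let p := char_poly (F^T *m F) in
  flatten [seq nseq (mup x p) (Num.sqrt x) | x <- rootsR p].

Definition SL (R : realType) (n : nat) : set 'M[R]_n :=
  [set F | \det F = 1].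

Definition tensor (R : realType) (n : nat) (a b : 'cV[R]_n) : 'M[R]_n :=
  a *m b^T.

(* W is a total function on matrices, but only its values on SL(3) matter:
   every segment quantified over lies in SL(3). *)
Definition rank_one_convex_SL3 (R : realType) (W : 'M[R]_3 -> R) : Prop :=
  forall (F : 'M[R]_3) (a b : 'cV[R]_3),
    F \in @SL R 3 ->
    (forall t : R, t \in `[0, 1] -> F + t *: tensor a b \in @SL R 3) ->
    @convex_function R R^o `[0 : R, 1] (fun t : R => W (F + t *: tensor a b)).

Definition hencky (R : realType) (mu : R) (F : 'M[R]_3) : R :=
  mu * \sum_(l <- singular_values F) ln l ^+ 2.

(* Main.v *)
(* The simple shear [1 + t e1 e2^T] with [t = l - 1/l] has singular values
   [1, l, 1/l], hence energy [2 mu ln^2 l], which grows only like [ln^2 t] and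
   so is not convex in [t]. Concretely, on the segment from [t = 0] ([l = 1]) to
   [t = 16 - 1/16], the point of weight 4/17 is [t = 4 - 1/4], and its energy
   is 1/4 of the energy at the far endpoint, whereas 1/4 > 4/17. *)

Require Import Defs.
From mathcomp Require Import all_boot all_order all_algebra.
From mathcomp Require Import reals.
From mathcomp Require Import ring lra polyrcf boolp classical_sets.
From mathcomp Require Import set_interval interval_inference exp convex.
Set Implicit Arguments.
Unset Strict Implicit.


Import Order.TTheory GRing.Theory Num.Theory.
Local Open Scope ring_scope.

Lemma det_mx33 (R : comNzRingType) (A : 'M[R]_3) :
  \det A = A 0 0 * (A 1 1 * A 2 2 - A 1 2 * A 2 1)
         - A 0 1 * (A 1 0 * A 2 2 - A 1 2 * A 2 0)
         + A 0 2 * (A 1 0 * A 2 1 - A 1 1 * A 2 0).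
Proof.
(* Indexing by [nat] lets the nested [lift]s compute. *)
pose f (i j : nat) := A (inord i) (inord j).
have Af i j : A i j = f i j by rewrite /f !inord_val.
rewrite (expand_det_row _ 0) !big_ord_recl big_ord0 /cofactor.
rewrite !(expand_det_row _ 0) !big_ord_recl !big_ord0 /cofactor !det_mx11.
rewrite !mxE !Af /= /bump /=; ring.
Qed.

(** When the characteristic polynomial splits as the product over [s], the multiplicity of a root is
    its count in [s], so repeating each distinct root that often rebuilds [s] up to order. *)
Lemma perm_singular_values (R : realType) (n : nat) (F : 'M[R]_n) (s : seq R) :
  char_poly (F^T *m F) = \prod_(x <- s) ('X - x%:P) ->
  perm_eq (singular_values F) (map Num.sqrt s).
Proof.
move=> Fs; rewrite /singular_values.
set p := char_poly _ in Fs *.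
have p0 : p != 0 by rewrite monic_neq0 ?char_poly_monic.
have roots_s : perm_eq (rootsR p) (undup s).
  apply: uniq_perm; rewrite ?undup_uniq ?uniq_roots // => x.
  by rewrite mem_undup -roots_on_rootsR // Fs root_prod_XsubC in_itv.
have -> : [seq nseq (mup x p) (Num.sqrt x) | x <- rootsR p] =
    map (map Num.sqrt) [seq nseq (count_mem x s) x | x <- rootsR p].
  by rewrite -map_comp; apply: eq_map => x; rewrite /= map_nseq Fs mu_prod_XsubC.
rewrite -map_flatten perm_map // -(permPr (perm_count_undup s)).
exact/perm_flatten/perm_map.
Qed.

Definition shear (R : realType) (t : R) : 'M[R]_3 :=
  1%:M + t *: tensor (delta_mx 0 0) (delta_mx 1 0).

Lemma det_shear (R : realType) (t : R) : \det (shear t) = 1.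
Proof.
by rewrite det_mx33 /shear /tensor trmx_delta mul_delta_mx !mxE /=; ring.
Qed.

(* The roots come from [t ^+ 2 + 2 = l ^+ 2 + l ^- 2] for [t = l - l^-1]. *)
Lemma char_poly_shear (R : realType) (l : R) : l != 0 ->
  char_poly ((shear (l - l^-1))^T *m shear (l - l^-1)) =
  \prod_(x <- [:: 1; l ^+ 2; l^-1 ^+ 2]) ('X - x%:P).
Proof.
move=> l0; have ll : l%:P * (l^-1)%:P = 1 by rewrite -polyCM divff.
rewrite !big_cons big_nil /char_poly det_mx33 /shear /tensor trmx_delta mul_delta_mx.
rewrite !(mxE, big_ord_recl, big_ord0) /=.
rewrite !(mulr0, mulr1, mul0r, addr0, add0r, mulr0n, mulr1n).
move: ll; rewrite ?(polyCD, polyCN, polyCM, polyC_exp, polyC0, polyC1, rmorphMn) /=.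
move: l%:P (l^-1)%:P => a b ab.
(* The two sides differ by a multiple of [1 - a * b], which vanishes by [ab]. *)
apply/subr0_eq/(@eq_trans _ _ (('X - 1) * (1 - a * b) * (1 + a * b - 2 * 'X))).
  by ring.
by rewrite ab subrr mulr0 mul0r.
Qed.

Lemma hencky_shear (R : realType) (mu l : R) : 0 < l ->
  hencky mu (shear (l - l^-1)) = mu * (2 * ln l ^+ 2).
Proof.
move=> l0; have ln0 : l != 0 by rewrite gt_eqF.
rewrite /hencky (perm_big _ (perm_singular_values (char_poly_shear ln0))) /=.
rewrite !big_cons big_nil sqrtr1 !sqrtr_sqr !gtr0_norm ?invr_gt0 //.
by rewrite ln1 lnV ?posrE //; ring.
Qed.

Theorem proposition3p2 (R : realType) (mu : R) (hmu : 0 < mu) :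
  ~ rank_one_convex_SL3 (hencky mu).
Proof.
pose c : R := 16 - 16^-1.
pose a : 'cV[R]_3 := c *: delta_mx 0 0.
have segE (t : R) : 1%:M + t *: tensor a (delta_mx 1 0) = shear (t * c).
  by rewrite /shear /tensor -scalemxAl scalerA.
have SL1 : 1%:M \in @SL R 3 by rewrite inE /SL /= det1.
have segSL t : t \in `[(0 : R), 1] -> 1%:M + t *: tensor a (delta_mx 1 0) \in @SL R 3.
  by move=> _; rewrite segE inE; apply: det_shear.
have p0 : (0 : R) <= 4 / 17 by lra.
have p1 : (4 / 17 : R) <= 1 by lra.
have in1 : (1 : R) \in `[(0 : R), 1]%classic by rewrite inE /= in_itv /= lexx ler01.
have in0 : (0 : R) \in `[(0 : R), 1]%classic by rewrite inE /= in_itv /= lexx ler01.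
(* The weight [4 / 17] goes to the first point, so [1] is given before [0]. *)
move=> /(_ _ _ _ SL1 segSL (Itv01 p0 p1) _ _ in1 in0).
rewrite !segE convRE /= /unstable.onem.
have -> : ((4 / 17)%:A + (1 - 4 / 17) *: (0 : R^o)) * c = 4 - 4^-1.
  by rewrite scaler0 addr0 [_%:A]mulr1 /c; field.
have -> : 1 * c = 16 - 16^-1 by rewrite mul1r.
(* Writing [0] in the form [l - l^-1] with [l = 1] lets [hencky_shear] apply to this endpoint
   too. *)
have -> : 0 * c = 1 - 1^-1 by rewrite mul0r invr1 subrr.
rewrite !hencky_shear ?ltr0n // ln1.
have -> : ln 16 = 2 * ln 4 :> R.
  by rewrite (_ : 16 = 4 * 4) ?lnM ?posrE ?ltr0n //; ring.
have ln4 : 0 < mu * ln (4 : R) ^+ 2 by rewrite mulr_gt0 // exprn_gt0 // ln_gt0 ?ltr1n.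
(* Dividing the convexity inequality by [2 * mu * ln 4 ^+ 2] would leave [1 <= 16 / 17]. *)
rewrite leNgt => /negP; apply; lra.
Qed.
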